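(* The $g$-vector $(g_0,\dots,g_{d+1})$ of any member $M$ of $\mathcal{W}_k(d)$ satisfies $$\frac{g_j}{\binom{d+2}{j}}=(-1)^{j-k-1}\frac{g_{k+1}}{\binom{d+2}{k+1}}\quad\text{for } k+1<j\le d-k+1.$$ If, further, $d\ge 2k$ and $d$ is even, then the Euler characteristic $\chi$ of $M$ is given by the formula $$(-1)^k(\chi-2)=\frac{2\,g_{k+1}}{\binom{d+2}{k+1}}.$$
   Context: All simplicial complexes are finite and abstract, with the empty set as a face. For a finite set $\alpha$, $\overline{\alpha}$ is the complex of all subsets of $\alpha$ and $\partial\alpha$ the complex of all proper subsets. The join $X\ast Y$ (disjoint vertex sets) has as faces the disjoint unions of a face of $X$ and a face of $Y$. The standard sphere $S^d_{d+2}$ is $\partial\alpha$ with $\#\alpha=d+2$. Complexes are identified up to isomorphism. Bistellar moves: if $X$ is $d$-dimensional and $\alpha,\beta$ are disjoint nonempty sets with $\dim\alpha+\dim\beta=d$ (where $\dim\alpha=\#\alpha-1$) such that the set of faces of $X$ contained in $\alpha\sqcup\beta$ is exactly $\overline{\alpha}\ast\partial\beta$, then $Y=(X\setminus(\overline\alpha\ast\partial\beta))\cup(\partial\alpha\ast\overline\beta)$ is obtained from $X$ by the bistellar move $\alpha\mapsto\beta$, of index $\dim\beta$ (if $\beta$ is a single vertex, it is a new vertex). For $0\le k\le d+1$, a $d$-dimensional complex is $k$-stellated if it is obtained from $S^d_{d+2}$ by a finite sequence of bistellar moves, each of index $<k$ ($S^d_{d+2}$ is the only $0$-stellated one). The link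 of a vertex $x$ in $X$ is $\{\alpha\in X: x\notin\alpha,\ \alpha\sqcup\{x\}\in X\}$. For $0\le k\le d$, $\mathcal{W}_k(d)$ is the class of connected $d$-dimensional simplicial complexes all of whose vertex links are $k$-stellated $(d-1)$-spheres. $f_i(X)$ is the number of $i$-dimensional faces ($f_{-1}=1$), and $g_j(X)=\sum_{i=-1}^{j-1}(-1)^{j-i-1}\binom{d-i+1}{j-i-1}f_i(X)$ for $0\le j\le d+1$, $d=\dim X$. *)

(* Defs.v *)
From HB Require Import structures.
From mathcomp Require Import all_boot all_order all_algebra.
From mathcomp Require Import finmap.

Set Implicit Arguments.
Unset Strict Implicit.
Unset Printing Implicit Defensive.

Import Order.TTheory GRing.Theory Num.Theory.

Local Open Scope fset_scope.
Local Open Scope ring_scope.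

Definition is_complex (V : choiceType) (X : {fset {fset V}}) : Prop :=
  fset0 \in X /\
  forall s t : {fset V}, s \in X -> t `<=` s -> t \in X.

(* Dimensions are integers: the complex {fset0} has dimension -1. *)
Definition face_dim (V : choiceType) (s : {fset V}) : int := #|` s|%:Z - 1.

Definition has_dim (V : choiceType) (X : {fset {fset V}}) (d : int) : Prop :=
  (exists2 s, s \in X & face_dim s = d) /\
  (forall s, s \in X -> face_dim s <= d).

Definition full_simplex (V : choiceType) (a : {fset V}) : {fset {fset V}} :=
  fpowerset a.

Definition boundary (V : choiceType) (a : {fset V}) : {fset {fset V}} :=
  fpowerset a `\ a.

Definition join (V : choiceType) (X Y : {fset {fset V}}) : {fset {fset V}} :=
  [fset s `|` t | s in X, t in Y].

Definition isomorphic (V W : choiceType) (X : {fset {fset V}})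
    (Y : {fset {fset W}}) : Prop :=
  exists2 f : V -> W,
    (forall x y, [fset x] \in X -> [fset y] \in X -> f x = f y -> x = y) &
    Y = [fset f @` (s : {fset V}) | s in X].

Definition bistellar_move (V : choiceType) (d : int) (a b : {fset V})
    (X Y : {fset {fset V}}) : Prop :=
  [/\ is_complex X /\ has_dim X d,
      [/\ a != fset0, b != fset0 & [disjoint a & b]],
      face_dim a + face_dim b = d,
      [fset s in X | s `<=` a `|` b] = join (full_simplex a) (boundary b) &
      Y = (X `\` join (full_simplex a) (boundary b))
            `|` join (boundary a) (full_simplex b)].

Inductive obtained_by_moves (V : choiceType) (k : nat) (d : int) :
    {fset {fset V}} -> Prop :=
| Standard_sphere a :
    #|` a|%:Z = d + 2 -> obtained_by_moves k d (boundary a)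
| Move X Y a b :
    obtained_by_moves k d X -> bistellar_move d a b X Y ->
    face_dim b < k%:Z -> obtained_by_moves k d Y.

(* Complexes are considered up to isomorphism. The sequence of moves is carried
   out on the vertex set nat, so that new vertices are always available,
   whatever V is. *)
Definition stellated (V : choiceType) (k : nat) (d : int)
    (X : {fset {fset V}}) : Prop :=
  [/\ is_complex X, has_dim X d &
      exists2 Y : {fset {fset nat}},
        obtained_by_moves k d Y & isomorphic X Y].

Definition link (V : choiceType) (X : {fset {fset V}}) (x : V) :
    {fset {fset V}} :=
  [fset s in X | (x \notin s) && (x |` s \in X)].

(* Connectedness of the 1-skeleton. *)
Definition connected_complex (V : choiceType) (X : {fset {fset V}}) : Prop :=
  forall x y : V, [fset x] \in X -> [fset y] \in X ->
    exists2 p : seq V, path (fun u v => [fset u; v] \in X) x p & last x p = y.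

Definition in_W (V : choiceType) (k d : nat) (X : {fset {fset V}}) : Prop :=
  [/\ is_complex X, has_dim X d%:Z, connected_complex X &
      forall x, [fset x] \in X -> stellated k (d%:Z - 1) (link X x)].

Definition face_number (V : choiceType) (X : {fset {fset V}}) (i : int) : nat :=
  #|` [fset s in X | face_dim s == i]|.

(* The parameter d is the dimension of X. The usual summation index i, from -1
   to j - 1, is m - 1 here, whence d - i + 1 = d + 2 - m and
   j - i - 1 = j - m. *)
Definition g_number (V : choiceType) (d : nat) (X : {fset {fset V}})
    (j : nat) : int :=
  \sum_(0 <= m < j.+1)
    (-1) ^+ (j - m) * 'C(d.+2 - m, j - m)%:Z
      * (face_number X (m%:Z - 1))%:Z.

(* Here too, d is the dimension of X. *)
Definition euler_char (V : choiceType) (d : nat) (X : {fset {fset V}}) : int :=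
  \sum_(0 <= i < d.+1) (-1) ^+ i * (face_number X i%:Z)%:Z.

(* Main.v *)
(* Encode the g-vector of a d-dimensional complex X as the polynomial
   G_X(x) = sum_(s in X) x^#s (1 - x)^(d + 2 - #s).  The standard sphere has
   G = 1 - x^(d + 2), and a move a -> b adds x^#b - x^#a with #a + #b = d + 2;
   hence G of a k-stellated sphere is antisymmetric and its coefficients vanish
   strictly between k and d + 2 - k.  Double counting the pairs (vertex, face)
   gives (1 - x) G_M' + (d + 2) G_M = sum_v G_(link v), so that
   (j + 1) g_(j+1) + (d + 2 - j) g_j is zero in the middle range, which is the
   first claim.  Antisymmetry of the link sum gives the same recurrence, for
   all j, for g_j + g_(d+2-j); its value at 0 is 2 - chi when d is even. *)
Require Import Defs.
From mathcomp Require Import all_boot all_order all_algebra.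
From mathcomp Require Import finmap.
From mathcomp Require Import zify ring.

Set Implicit Arguments.
Unset Strict Implicit.
Unset Printing Implicit Defensive.

Import Order.TTheory GRing.Theory Num.Theory.
Local Open Scope fset_scope.
Local Open Scope ring_scope.

(** * Weighted face sums of simplices, boundaries and joins *)

Lemma sum_fpowerset (R : comNzRingType) (V : choiceType) (x y : R)
    (a : {fset V}) :
  \sum_(s <- fpowerset a) x ^+ #|` s| * y ^+ (#|` a| - #|` s|) =
  (x + y) ^+ #|` a|.
Proof.
elim/finSet_rect: a => a IH.
have [->|[v va]] := fset_0Vmem a.
  by rewrite fpowerset0 big_seq_fset1 cardfs0 subnn !expr0 mulr1.
have cav : #|` a| = #|` a `\ v|.+1 by rewrite (cardfsD1 v) va.
rewrite (big_fsetID _ (fun s : {fset V} => v \in s)) /=.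
rewrite cav exprS mulrDl -(IH _ (fproperD1 va)) !mulr_sumr.
congr (_ + _); last first.
  have -> : [fset s in fpowerset a | v \notin s] = fpowerset (a `\ v).
    by apply/fsetP => s; rewrite !inE /= !fpowersetE fsubsetD1.
  apply: eq_fbigr => s; rewrite fpowersetE => /fsubset_leq_card hs _.
  by rewrite subSn // exprS mulrCA.
have -> : [fset s in fpowerset a | v \in s] =
    [fset v |` s | s in fpowerset (a `\ v)].
  apply/fsetP => s; rewrite !inE /= fpowersetE.
  apply/andP/imfsetP => [[sa vs]|[t /=]].
    by exists (s `\ v); rewrite /= ?fsetD1K // fpowersetE fsetSD.
  rewrite fpowersetE fsubsetD1 => /andP[ta vt] ->.
  by rewrite fsubUset fsub1set va ta fset1U1.
rewrite big_imfset /=; last first.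
  move=> s t; rewrite !fpowersetE !fsubsetD1 => /andP[_ vs] /andP[_ vt] est.
  by rewrite -(fsetU1K vs) est fsetU1K.
apply: eq_fbigr => s; rewrite fpowersetE fsubsetD1 => /andP[_ vs] _.
by rewrite cardfsU1 vs add1n subSS exprS mulrA.
Qed.

Lemma sum_boundary (R : comNzRingType) (V : choiceType) (x y : R)
    (a : {fset V}) :
  \sum_(s <- boundary a) x ^+ #|` s| * y ^+ (#|` a| - #|` s|) =
  (x + y) ^+ #|` a| - x ^+ #|` a|.
Proof.
rewrite -sum_fpowerset [in RHS](big_fsetD1 a) ?fpowersetE //=.
by rewrite subnn expr0 mulr1 [RHS]addrC addKr.
Qed.

(** A face of the join determines its two parts, as its traces on [a] and [b]; so the sum
    factors. *)
Lemma sum_join (R : comNzRingType) (V : choiceType) (x y : R)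
    (a b : {fset V}) (S T : {fset {fset V}}) :
  S `<=` fpowerset a -> T `<=` fpowerset b -> [disjoint a & b] ->
  \sum_(u <- join S T) x ^+ #|` u| * y ^+ (#|` a| + #|` b| - #|` u|) =
  (\sum_(s <- S) x ^+ #|` s| * y ^+ (#|` a| - #|` s|)) *
  (\sum_(t <- T) x ^+ #|` t| * y ^+ (#|` b| - #|` t|)).
Proof.
move=> /fsubsetP Sa /fsubsetP Tb dab.
have trace s t : s `<=` a -> t `<=` b ->
    (s `|` t) `&` a = s /\ (s `|` t) `&` b = t.
  move=> sa tb.
  have dsb : [disjoint s & b] by apply: fdisjointWl dab.
  have dat : [disjoint t & a] by rewrite fdisjoint_sym; apply: fdisjointWr dab.
  rewrite !fsetIUl (fsetIidPl sa) (fsetIidPl tb).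
  by rewrite (eqP dsb) (eqP dat) fsetU0 fset0U.
rewrite big_imfset2 /=; last first.
  move=> [s t] [s' t']; rewrite !inE /= => /andP[sS tT] /andP[s'S t'T] e.
  have [] := trace s t; rewrite -?fpowersetE; [exact: Sa|exact: Tb|].
  have [] := trace s' t'; rewrite -?fpowersetE; [exact: Sa|exact: Tb|].
  by rewrite e => -> -> -> ->.
rewrite mulr_suml; apply: eq_fbigr => s /Sa; rewrite fpowersetE => sa _.
rewrite mulr_sumr; apply: eq_fbigr => t /Tb; rewrite fpowersetE => tb _.
have dst : [disjoint s & t] by apply: fdisjointWl sa (fdisjointWr tb dab).
rewrite cardfsU (eqP dst) cardfs0 subn0.
have := fsubset_leq_card sa; have := fsubset_leq_card tb => ht hs.
have -> : (#|` a| + #|` b| - (#|` s| + #|` t|) =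
  (#|` a| - #|` s|) + (#|` b| - #|` t|))%N by lia.
by rewrite !exprD mulrACA.
Qed.

(** * The g-polynomial and its change under a bistellar move *)

(** [n] is a parameter, since a complex of dimension d uses d + 2 and its vertex links use d + 1. *)
Definition g_poly (V : choiceType) (n : nat) (X : {fset {fset V}}) :
  {poly int} := \sum_(s <- X) 'X^#|` s| * (1 - 'X) ^+ (n - #|` s|).

Lemma g_poly_boundary (V : choiceType) (a : {fset V}) :
  g_poly #|` a| (boundary a) = 1 - 'X^#|` a|.
Proof. by rewrite /g_poly sum_boundary (addrC 'X) subrK expr1n. Qed.

Lemma bigsum_fsetU (R : zmodType) (I : choiceType) (A B : {fset I}) (F : I -> R) :
  [disjoint A & B] ->
  \sum_(i <- A `|` B) F i = \sum_(i <- A) F i + \sum_(i <- B) F i.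
Proof.
move=> dAB; rewrite (big_fsetID _ (mem A)) /=; congr (_ + _);
  apply: eq_fbigl => i; rewrite !inE.
  by case: (i \in A); rewrite ?andbF.
have [iA|] := boolP (i \in A); rewrite ?andbF ?andbT //=.
by rewrite (negbTE (fdisjointP dAB _ iA)).
Qed.

Lemma g_poly_move (V : choiceType) (d : int) (a b : {fset V})
    (X Y : {fset {fset V}}) :
  bistellar_move d a b X Y ->
  g_poly (#|` a| + #|` b|) Y =
  g_poly (#|` a| + #|` b|) X + ('X^#|` b| - 'X^#|` a|).
Proof.
case=> _ [_ _ dab] _ eX ->.
set A := join _ _ in eX *; set B := join _ _.
have AX : A `<=` X by rewrite -eX; apply/fsubsetP => s; rewrite !inE => /andP[].
(* An inserted face lies in [a] ∪ [b]; were it already in [X], it would belong to the removed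
   join. *)
have dXB : [disjoint X `\` A & B].
  apply/fdisjointP => s; rewrite inE => /andP[sA sX]; apply: contra sA.
  case/imfset2P => u /= + [v /=]; rewrite !inE !fpowersetE.
  move=> /andP[_ ua] vb es; rewrite -eX !inE /= sX es.
  by rewrite fsetUSS.
have bda c : boundary c `<=` fpowerset c by apply: fsubD1set.
rewrite /g_poly bigsum_fsetU //.
have -> : \sum_(s <- X) 'X^#|` s| * (1 - 'X) ^+ (#|` a| + #|` b| - #|` s|) =
   \sum_(s <- X `\` A) 'X^#|` s| * (1 - 'X) ^+ (#|` a| + #|` b| - #|` s|)
   + \sum_(s <- A) 'X^#|` s| * (1 - 'X) ^+ (#|` a| + #|` b| - #|` s|)
     :> {poly int}.
  rewrite -bigsum_fsetU; last by apply/fdisjointP => s; rewrite inE => /andP[].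
  by rewrite fsetUC -{1}(fsetIidPr AX) fsetID.
rewrite !sum_join // ?sum_boundary ?sum_fpowerset ?(addrC 'X) ?subrK ?expr1n.
ring.
Qed.

Lemma coef_exp_1subX (R : comNzRingType) p i :
  ((1 - 'X) ^+ p)`_i = (-1) ^+ i * 'C(p, i)%:R :> R.
Proof.
elim: p i => [|p IH] i.
  by rewrite expr0 coef1 bin0n; case: i => [|i]; rewrite ?mulr1 ?mulr0.
rewrite exprS mulrBl mul1r coefB coefXM !IH.
case: i => [|i] /=; first by rewrite !bin0 subr0.
by rewrite binS natrD exprS; ring.
Qed.

Lemma coef_g_poly (V : choiceType) (X : {fset {fset V}}) d j :
  (g_poly d.+2 X)`_j = g_number d X j.
Proof.
have fn m : (face_number X (m%:Z - 1))%:Z = \sum_(s <- X | #|` s| == m) 1 :> int.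
  rewrite -natz /face_number card_fset_sum1 natr_sum big_fset /=.
  by apply: eq_bigl => s; rewrite /face_dim; apply/eqP/eqP; lia.
rewrite /g_poly coef_sum /g_number.
under [RHS]eq_bigr => m _ do
  rewrite fn mulr_sumr big_mkcond /=.
rewrite exchange_big /=; apply: eq_bigr => s _.
rewrite -big_mkcond /= coefXnM ltnNge.
have [sj|sj] := leqP #|` s| j.
  rewrite big_mkord (bigD1 (Ordinal (n := j.+1) (m := #|`s|) sj)) ?eqxx //=.
  rewrite big1 ?addr0 ?coef_exp_1subX ?mulr1 ?natz // => i /andP[/eqP h /eqP []].
  exact/val_inj.
rewrite big_mkord big1 // => i /eqP h; have := ltn_ord i; lia.
Qed.

(** * Vertex links and the derivative of the g-polynomial *)

(** Adding [v] is a bijection from the link onto the faces containing [v]; it raises the cardinality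
    by one, whence the predecessors. *)
Lemma g_poly_link (V : choiceType) (n : nat) (X : {fset {fset V}}) (v : V) :
  is_complex X ->
  g_poly n (link X v) =
  \sum_(s <- X | v \in s) 'X^(#|` s|.-1) * (1 - 'X) ^+ (n - #|` s|.-1).
Proof.
case=> _ sub; rewrite [RHS]big_fset_condE.
have -> : [fset s in X | v \in s] = [fset v |` s | s in link X v].
  apply/fsetP => s; rewrite !inE /=; apply/andP/imfsetP => [[sX vs]|[t /=]].
    exists (s `\ v); rewrite /= ?fsetD1K // !inE /= eqxx fsetD1K // sX andbT.
    by rewrite (sub _ _ sX) // fsubD1set.
  by rewrite !inE /= => /and3P[_ _ ?] ->; rewrite fset1U1.
rewrite big_imfset /=; last first.
  move=> s t; rewrite !inE /= => /and3P[_ vs _] /and3P[_ vt _] est.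
  by rewrite -(fsetU1K vs) est fsetU1K.
apply: eq_fbigr => s; rewrite !inE /= => /and3P[_ vs _] _.
by rewrite cardfsU1 vs.
Qed.

(** With p = n + 1 - m, the terms in p cancel and m x^(m-1) (1-x)^p ((1-x) + x) remains. *)
Lemma deriv_g_poly_term (R : comNzRingType) m n : (m <= n.+1)%N ->
  (1 - 'X) * ('X^m * (1 - 'X) ^+ (n.+1 - m))^`()
    + ('X^m * (1 - 'X) ^+ (n.+1 - m)) *+ n.+1 =
  ('X^(m.-1) * (1 - 'X) ^+ (n - m.-1)) *+ m :> {poly R}.
Proof.
move=> hm; have [p ep] : {p | (n.+1 = m + p)%N} by exists (n.+1 - m)%N; lia.
rewrite ep addKn derivM derivXn deriv_exp derivB derivC derivX sub0r mulN1r.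
(* At [m = 0] the truncated predecessor is harmless: the right side has multiplicity 0. *)
case: m hm ep => [|m] hm ep /=.
  by case: p ep => // p ep; rewrite !exprS !mulr0n; ring.
have -> : (n - m = p)%N by lia.
by case: p ep => [|p] ep; rewrite /= ?exprS; ring.
Qed.

Lemma g_poly_sum_links (V : choiceType) (n : nat) (X : {fset {fset V}}) :
  is_complex X -> (forall s, s \in X -> (#|` s| <= n.+1)%N) ->
  (1 - 'X) * (g_poly n.+1 X)^`() + g_poly n.+1 X *+ n.+1 =
  \sum_(v <- \bigcup_(s <- X) s) g_poly n (link X v).
Proof.
move=> cX hX; under [RHS]eq_bigr do rewrite g_poly_link // big_mkcond.
rewrite exchange_big /g_poly raddf_sum mulr_sumr -sumrMnl -big_split /=.
apply: eq_fbigr => s sX _; rewrite -big_mkcond /=.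
rewrite big_fset_condE.
have -> : [fset v in \bigcup_(t <- X) t | v \in s] = s.
  apply/fsetP => v; rewrite !inE /=; case: (boolP (v \in s)); rewrite ?andbF //.
  by move=> vs; rewrite andbT; apply/bigfcupP; exists s; rewrite ?sX.
(* Each face is counted once per vertex it contains. *)
rewrite big_const_seq count_predT.
by rewrite iter_addr_0 deriv_g_poly_term // hX.
Qed.

(** * The shape of the g-polynomial of a stellated sphere *)

(* [n] is d + 2 for a complex of dimension d: antisymmetry is the
   Dehn-Sommerville equations, and [k] bounds the indices of the moves. *)
Definition stellated_shape (k n : nat) (p : {poly int}) : Prop :=
  (forall j, (j <= n)%N -> p`_j = - p`_(n - j)) /\
  (forall j, (k < j)%N -> (j < n - k)%N -> p`_j = 0).

Lemma stellated_shapeD k n p q :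
  stellated_shape k n p -> stellated_shape k n q -> stellated_shape k n (p + q).
Proof.
move=> [pa pz] [qa qz]; split=> j; rewrite !coefD.
  by move=> jn; rewrite pa // qa // opprD.
by move=> kj jn; rewrite pz // qz // addr0.
Qed.

(** The case [b = 0] is the standard sphere; other values of [b] are the increments made by
    moves. *)
Lemma stellated_shape_monomials k n b : (b <= k)%N -> (b <= n)%N ->
  stellated_shape k n ('X^b - 'X^(n - b)).
Proof.
move=> bk bn; split=> j; rewrite !coefB !coefXn.
  move=> jn; rewrite opprB.
  have -> : (n - j == n - b)%N = (j == b) by apply/eqP/eqP; lia.
  by have -> : (n - j == b)%N = (j == n - b)%N by apply/eqP/eqP; lia.
move=> kj jn; have -> : (j == b) = false by apply/eqP; lia.
by have -> : (j == n - b)%N = false by apply/eqP; lia.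
Qed.

Lemma obtained_by_moves_g_poly (V : choiceType) k (d : int) n
    (X : {fset {fset V}}) :
  obtained_by_moves k d X -> n%:Z = d + 2 -> stellated_shape k n (g_poly n X).
Proof.
move=> + dn; elim=> [a ad|Y Z a b _ IH mv bk].
  have -> : n = #|` a| by lia.
  rewrite g_poly_boundary -[1](expr0 'X) -[X in _ - 'X^X]subn0.
  exact: stellated_shape_monomials.
have abn : n = (#|` a| + #|` b|)%N.
  by case: mv => _ _; rewrite /face_dim => + _ _; lia.
rewrite abn (g_poly_move mv) -abn; apply: stellated_shapeD => //.
have -> : #|` a| = (n - #|` b|)%N by lia.
(* Index below [k] means at most [k] vertices in [b]. *)
by apply: stellated_shape_monomials; move: bk; rewrite /face_dim; lia.
Qed.

Lemma g_poly_isomorphic (V W : choiceType) n (X : {fset {fset V}})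
    (Y : {fset {fset W}}) :
  is_complex X -> isomorphic X Y -> g_poly n Y = g_poly n X.
Proof.
case=> _ sub [f finj ->]; rewrite /g_poly.
have vert s x : s \in X -> x \in s -> [fset x] \in X.
  by move=> sX xs; apply: sub sX _; rewrite fsub1set.
rewrite big_imfset /=; last first.
  (* [f] is injective only on vertices of [X], so points of faces must first be recognised as
     vertices. *)
  have incl s t : s \in X -> t \in X -> f @` s = f @` t -> s `<=` t.
    move=> sX tX e; apply/fsubsetP => x xs.
    have : f x \in f @` t by rewrite -e in_imfset.
    case/imfsetP => y /= yt /finj -> //; exact: vert xs || exact: vert yt.
  move=> s t sX tX e; apply/eqP; rewrite eqEfsubset.
  by rewrite (incl s t) // (incl t s).
apply: eq_fbigr => s sX _; rewrite card_in_imfset //= => x y xs ys.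
by apply: finj; [exact: vert xs|exact: vert ys].
Qed.

Lemma stellated_g_poly (V : choiceType) k (d : int) n (X : {fset {fset V}}) :
  stellated k d X -> n%:Z = d + 2 -> stellated_shape k n (g_poly n X).
Proof.
case=> cX _ [Y mY iXY] dn.
by rewrite -(g_poly_isomorphic n cX iXY); apply: obtained_by_moves_g_poly mY dn.
Qed.

(* [p] is the sum of the g-polynomials of the vertex links. *)
Lemma in_W_g_number (V : choiceType) k d (X : {fset {fset V}}) :
  in_W k d X -> exists2 p : {poly int}, stellated_shape k d.+1 p &
  forall j, (j <= d.+2)%N ->
    j.+1%:R * g_number d X j.+1 + (d.+2 - j)%:R * g_number d X j = p`_j.
Proof.
case=> cX [_ dimX] _ linkX.
exists (\sum_(v <- \bigcup_(s <- X) s) g_poly d.+1 (link X v)).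
  rewrite big_seq; elim/big_rec: _ => [|v p vX IH].
    by split=> j; rewrite !coef0 ?oppr0.
  apply: stellated_shapeD => //; apply: stellated_g_poly (_ : _ = d%:Z - 1 + 2).
    apply: linkX; case/bigfcupP: vX => s /andP[sX _] vs.
    by case: cX => _ sub; apply: sub sX _; rewrite fsub1set.
  by lia.
move=> j jd; rewrite -g_poly_sum_links //; last first.
  by move=> s /dimX; rewrite /face_dim; lia.
(* At degree [j], (1 - x) G' gives (j+1) g_(j+1) - j g_j, to which (d+2) g_j is added. *)
rewrite mulrBl mul1r coefD coefB coefXM coefMn !coef_deriv !coef_g_poly.
rewrite natrB //; case: j jd => [|j] jd /=; ring.
Qed.

(** * Solving the recurrence *)

(** Since (j+1) C(n,j+1) = (n-j) C(n,j), the quotient by the binomial merely changes sign at each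
    step. *)
Lemma binomial_recurrence (F : numFieldType) n a b (g : nat -> F) :
  (b <= n)%N ->
  (forall j, (a <= j)%N -> (j < b)%N ->
    j.+1%:R * g j.+1 + (n - j)%:R * g j = 0) ->
  forall j, (a <= j)%N -> (j <= b)%N ->
    g j / 'C(n, j)%:R = (-1) ^+ (j - a) * (g a / 'C(n, a)%:R).
Proof.
move=> bn rec j aj; rewrite -(subnKC aj) addKn.
elim: (j - a)%N => [|i IH] ib; first by rewrite addn0 mul1r.
rewrite exprS mulN1r mulNr -IH; last lia.
rewrite addnS in ib *; set m := (a + i)%N in ib *.
have Cm1 : 'C(n, m.+1)%:R != 0 :> F by rewrite pnatr_eq0 -lt0n bin_gt0; lia.
have Cm : 'C(n, m)%:R != 0 :> F by rewrite pnatr_eq0 -lt0n bin_gt0; lia.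
have m1 : m.+1%:R != 0 :> F by rewrite pnatr_eq0.
have eC : m.+1%:R * 'C(n, m.+1)%:R = (n - m)%:R * 'C(n, m)%:R :> F.
  by rewrite -!natrM mul_bin_left.
have eg := rec m (leq_addr _ _) ib.
rewrite -mulNr; apply/eqP; rewrite eqr_div //; apply/eqP.
apply: (mulfI m1).
have -> : m.+1%:R * (g m.+1 * 'C(n, m)%:R) =
  (m.+1%:R * g m.+1 + (n - m)%:R * g m) * 'C(n, m)%:R -
   g m * ((n - m)%:R * 'C(n, m)%:R) by ring.
by rewrite eg -eC; ring.
Qed.

(** * Extreme g-numbers and the two claims *)

Lemma face_number_empty (V : choiceType) (X : {fset {fset V}}) :
  is_complex X -> face_number X (-1) = 1%N.
Proof.
case=> X0 _; rewrite /face_number -[RHS](cardfs1 (fset0 : {fset V})).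
congr #|` _|; apply/fsetP => s; rewrite !inE /= /face_dim.
apply/andP/eqP => [[_ /eqP h]|->]; last by rewrite cardfs0.
by apply/eqP; rewrite -cardfs_eq0; lia.
Qed.

Lemma g_number0 (V : choiceType) d (X : {fset {fset V}}) :
  is_complex X -> g_number d X 0 = 1.
Proof.
move=> cX; rewrite /g_number big_nat1 subnn bin0.
by rewrite sub0r face_number_empty.
Qed.

(** All binomials are 1. The empty face gives 1, the last summand vanishes for lack of faces with d
    + 2 vertices, and the others give the alternating sum with reversed sign. *)
Lemma g_number_top (V : choiceType) d (X : {fset {fset V}}) :
  is_complex X -> has_dim X d%:Z -> ~~ odd d ->
  g_number d X d.+2 = 1 - euler_char d X.
Proof.
move=> cX [_ dimX] evd; rewrite /g_number big_nat_recl // big_nat_recr //=.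
have -> : face_number X (d.+2%:Z - 1) = 0%N.
  apply/eqP; rewrite cardfs_eq0; apply/eqP/fsetP => s; rewrite !inE /=.
  by apply/andP => -[/dimX + /eqP]; lia.
rewrite mulr0 addr0 subn0 binn sub0r face_number_empty // !mulr1.
congr (_ + _); first by rewrite -signr_odd /= negbK (negbTE evd).
rewrite /euler_char -sumrN; apply: eq_big_nat => i /andP[_ id1].
rewrite subSS binn mulr1 (_ : i.+1%:Z - 1 = i%:Z); last lia.
rewrite -mulNr; congr (_ * _).
rewrite -signr_odd -[in RHS]signr_odd oddB ?(ltnW id1) //= evd.
by case: odd.
Qed.

Theorem proposition4p8 (V : choiceType) (k d : nat) (M : {fset {fset V}})
    (hkd : (k <= d)%N) (hM : in_W k d M) :
  (forall j : nat, (k + 1 < j)%N -> (j <= d - k + 1)%N ->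
     (g_number d M j)%:~R / 'C(d + 2, j)%:R =
     (-1) ^+ (j - k - 1)
       * ((g_number d M (k + 1))%:~R / 'C(d + 2, k + 1)%:R) :> rat) /\
  ((2 * k <= d)%N -> ~~ odd d ->
     (-1) ^+ k * ((euler_char d M)%:~R - 2) =
     2 * (g_number d M (k + 1))%:~R / 'C(d + 2, k + 1)%:R :> rat).
Proof.
have [p [pa pz] prec] := in_W_g_number hM.
pose g j : rat := (g_number d M j)%:~R.
have grec j : (j <= d.+2)%N ->
    j.+1%:R * g j.+1 + (d.+2 - j)%:R * g j = (p`_j)%:~R.
  by move=> jd; rewrite -prec // intrD !intrM !natz.
(* The link sum vanishes for k < i < d + 1 - k, so the recurrence carries [g] from k + 1 up to d - k
   + 1. *)
have middle j : (k.+1 <= j)%N -> (j <= d - k + 1)%N ->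
    g j / 'C(d.+2, j)%:R = (-1) ^+ (j - k.+1) * (g k.+1 / 'C(d.+2, k.+1)%:R).
  apply: binomial_recurrence => [|i ki ib]; first lia.
  by rewrite grec ?pz //; lia.
rewrite !addn1 addn2; split=> [j kj jd|kd evd].
  by rewrite -subnDA addn1; apply: middle; lia.
case: hM => cM dimM _ _.
pose s j := g j + g (d.+2 - j)%N.
have /(_ k.+1) : forall j, (0 <= j)%N -> (j <= d.+2)%N ->
    s j / 'C(d.+2, j)%:R = (-1) ^+ (j - 0) * (s 0 / 'C(d.+2, 0)%:R).
  apply: binomial_recurrence => // j _ jd.
  (* The reflection j -> d + 1 - j swaps the two coefficients of the recurrence and negates its
     right side, so the two instances add up to 0. *)
  have := grec (d.+1 - j)%N; have := grec j; rewrite [p`_j]pa; last lia.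
  rewrite /s (_ : d.+2 - (d.+1 - j) = j.+1)%N; last lia.
  rewrite -subSn; last lia.
  have -> : (d.+2 - j.+1 = d.+1 - j)%N by lia.
  rewrite intrN => /(_ (ltnW jd)) e1 /(_ ltac:(lia)) e2.
  move: (p`_(d.+1 - j))%:~R e1 e2 => q e1 e2.
  by rewrite !mulrDr addrACA e1 addrC [X in X + _]addrC e2 addrN.
rewrite subn0 bin0 divr1 /s subn0.
rewrite {3 4}/g g_number0 // g_number_top // => /(_ isT ltac:(lia)).
(* The reflected index d + 1 - k ends the middle range, at the even distance d - 2k from k + 1. So
   both summands of [s k.+1] are equal, whence the factor 2. *)
have := middle (d.+2 - k.+1)%N ltac:(lia) ltac:(lia).
rewrite bin_sub; last lia.
have -> : (-1) ^+ (d.+2 - k.+1 - k.+1) = 1 :> rat.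
  rewrite -signr_odd (_ : _ - _ - _ = d - k.*2)%N; last by rewrite -addnn; lia.
  by rewrite oddB ?odd_double ?(negbTE evd) // -mul2n.
rewrite mul1r mulrDl => -> e.
rewrite -[in RHS]mulrA mulr_natl -/(g k.+1) [RHS]mulr2n e exprS intrB; ring.
Qed.
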